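(* Let $D\ge1$ and $|{\bm{V}}|\ge2$ be integers. Let ${\bm{C}}\in\mathbb{R}^{D\times|{\bm{V}}|}$ have spectral norm $\|{\bm{C}}\|_2=\sigma_C$ and let ${\bm{h}}\in\mathbb{R}^D$ satisfy $|h_i|\le\sigma_h$ for all $i$. Set $\rho=\sigma_C\sigma_h$, ${\bm{u}}={\bm{C}}^\top{\bm{h}}\in\mathbb{R}^{|{\bm{V}}|}$, and $$\gamma=\exp\!\Big(-\rho\sqrt{\tfrac{D|{\bm{V}}|}{|{\bm{V}}|-1}}\Big).$$ Let $\mathcal{H}_{{\bm{u}}}=-\sum_{i=1}^{|{\bm{V}}|}p_i\log p_i$ be the entropy of ${\bm{p}}=\mathrm{softmax}({\bm{u}})$, $p_i=e^{u_i}/\sum_j e^{u_j}$. Then $$\mathcal{H}_{{\bm{u}}}\;\ge\;\log\big(1+(|{\bm{V}}|-1)\gamma\big)+\frac{\rho\,\gamma\sqrt{D|{\bm{V}}|(|{\bm{V}}|-1)}}{1+(|{\bm{V}}|-1)\gamma}.$$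
   Context: $\|\cdot\|_2$ is the spectral norm of a matrix; logarithms are natural. ${\bm{C}}$ plays the role of the language-model head (classifier) with hidden size $D$ and vocabulary size $|{\bm{V}}|$, ${\bm{h}}$ the final hidden state, and ${\bm{u}}$ the resulting logits. *)

(* Defs.v *)
From HB Require Import structures.
From mathcomp Require Import all_boot all_order all_algebra.
From mathcomp Require Import all_classical all_reals all_analysis.
Set Implicit Arguments. Unset Strict Implicit. Unset Printing Implicit Defensive.
Import Order.TTheory GRing.Theory Num.Theory.
Local Open Scope classical_set_scope.
Local Open Scope ring_scope.

Definition vnorm2 {R : realType} {n : nat} (v : 'cV[R]_n) : R :=
  Num.sqrt (\sum_(i < n) (v i ord0) ^+ 2).

Definition spec_norm {R : realType} {m n : nat} (C : 'M[R]_(m, n)) : R :=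
  sup [set vnorm2 (C *m x) | x in [set x : 'cV[R]_n | vnorm2 x = 1]].

Definition softmax {R : realType} {n : nat} (u : 'cV[R]_n) (i : 'I_n) : R :=
  expR (u i ord0) / \sum_(j < n) expR (u j ord0).

Definition softmax_entropy {R : realType} {n : nat} (u : 'cV[R]_n) : R :=
  - \sum_(i < n) softmax u i * ln (softmax u i).

(* Main.v *)
Require Import Defs.
From HB Require Import structures.
From mathcomp Require Import all_boot all_order all_algebra.
From mathcomp Require Import all_classical all_reals all_analysis.
From mathcomp Require Import ring lra.
Import Order.TTheory GRing.Theory Num.Theory.
Import numFieldNormedType.Exports.
Local Open Scope ring_scope.

(** Write [H u = ln Z - m], with [Z = sum_i e^(u_i)] and [m] the mean of [u]
    under softmax.  Since [|C^T h| <= sigmaC |h| <= rho sqrt D], it suffices to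
    bound [H] below on spheres, where it attains its minimum, at [v] say.
    Rotating [v] in the coordinate plane [(i, j)] must leave [H] stationary, so
    [e^(v_i) (1 - m / v_i)] does not depend on [i], and summing over [j] shows
    [sum_i v_i = 0] unless [v] is constant (where [H] is maximal).  Then [m > 0],
    the negative coordinates agree because [x |-> e^x (1 - m / x)] is increasing
    on [x < 0], and the positive ones all exceed [m].  Two positive coordinates
    are impossible: the same function increases on [x > m], so rotating them
    apart strictly decreases [H].  Hence [v] has one coordinate [a] and all
    others equal to [b], with [a - b = |v| sqrt (V / (V - 1))]; the entropy of
    such a vector is explicit and nonincreasing in [a - b]. *)

(** * Entropy as a function of the logits, and its derivative along curves and plane rotations *)

Section LogitEntropy.
Context {R : realType} {n : nat}.
Implicit Types (u : 'I_n -> R) (w : 'I_n -> R -> R).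

Definition partition_fun u : R := \sum_i expR (u i).

Definition gibbs_mean u : R :=
  (\sum_i u i * expR (u i)) / partition_fun u.

Definition logit_entropy u : R := ln (partition_fun u) - gibbs_mean u.

Lemma partition_fun_gt0 u (i : 'I_n) : 0 < partition_fun u.
Proof.
rewrite /partition_fun (bigD1 i) //=; apply: ltr_pwDl; first exact: expR_gt0.
by apply: sumr_ge0 => j _; exact: expR_ge0.
Qed.

(** Each [ln p_i] is [v_i - ln Z], and the [p_i] sum to 1. The index [i0] witnesses that the sum [Z]
    is nonempty, hence positive. *)
Lemma softmax_entropyE (v : 'cV[R]_n) (i0 : 'I_n) :
  softmax_entropy v = logit_entropy (fun i => v i ord0).
Proof.
have Z0 := partition_fun_gt0 (fun i => v i ord0) i0.
rewrite /softmax_entropy /logit_entropy /gibbs_mean /softmax.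
rewrite -/(partition_fun (fun i => v i ord0)).
set Z := partition_fun _ in Z0 *.
have -> : \sum_(i < n) expR (v i ord0) / Z * ln (expR (v i ord0) / Z) =
  (\sum_i v i ord0 * expR (v i ord0)) / Z - ln Z.
  rewrite (eq_bigr (fun i => (v i ord0 * expR (v i ord0)) / Z -
     expR (v i ord0) * (ln Z / Z))); last first.
    by move=> i _; rewrite ln_div ?posrE ?expR_gt0// expRK; ring.
  rewrite sumrB -!mulr_suml -/(partition_fun (fun i => v i ord0)) -/Z.
  by congr (_ - _); field; rewrite gt_eqF.
by rewrite opprB.
Qed.

Lemma is_derive_partition_fun w (dw : 'I_n -> R) (t : R) :
  (forall k, is_derive t 1 (w k) (dw k)) ->
  is_derive t 1 (fun s => partition_fun (w^~ s)) (\sum_k expR (w k t) * dw k).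
Proof.
move=> dwP.
have -> : (fun s => partition_fun (w^~ s)) = \sum_k (expR \o w k).
  by apply/funext => s; rewrite fct_sumE.
exact: is_derive_sum.
Qed.

Lemma is_derive_gibbs_mean w (dw : 'I_n -> R) (t : R) (i0 : 'I_n) :
  (forall k, is_derive t 1 (w k) (dw k)) ->
  is_derive t 1 (fun s => gibbs_mean (w^~ s))
    ((\sum_k (1 + w k t - gibbs_mean (w^~ t)) * expR (w k t) * dw k) /
     partition_fun (w^~ t)).
Proof.
move=> dwP.
have Z0 := partition_fun_gt0 (w^~ t) i0.
have dZ := is_derive_partition_fun _ _ _ dwP.
have dW : is_derive t 1 (\sum_k (w k * (expR \o w k)))
   (\sum_k (1 + w k t) * expR (w k t) * dw k).
  apply: is_derive_sum => k; apply: is_derive_eq.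
  by rewrite /= /GRing.scale /=; ring.
have dV := is_deriveV (lt0r_neq0 Z0) dZ.
have := is_deriveM dW dV.
set F := (X in is_derive t 1 X _); set dF := (X in is_derive t 1 _ X) => H.
have -> : (fun s => gibbs_mean (w^~ s)) = F.
  by apply/funext => s; rewrite /F /gibbs_mean /= mulrfctE fct_sumE.
apply: is_derive_eq H _; rewrite /dF /= /GRing.scale /=.
rewrite fct_sumE -/(partition_fun (w^~ t)) /gibbs_mean.
set Z := partition_fun _ in Z0 *; move: (\sum_i _) => W.
rewrite [X in X + _ = _]mulrA !mulr_sumr -big_split mulr_suml /=.
by apply: eq_bigr => k _; field; rewrite gt_eqF.
Qed.

(** The derivative of [ln Z] cancels the summand 1 in the factor [1 + w k t - m] from the derivative
    of the mean. *)
Lemma is_derive_logit_entropy w (dw : 'I_n -> R) (t : R) (i0 : 'I_n) :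
  (forall k, is_derive t 1 (w k) (dw k)) ->
  is_derive t 1 (fun s => logit_entropy (w^~ s))
    (- (\sum_k (w k t - gibbs_mean (w^~ t)) * expR (w k t) * dw k) /
     partition_fun (w^~ t)).
Proof.
move=> dwP.
have Z0 := partition_fun_gt0 (w^~ t) i0.
have dZ := is_derive_partition_fun _ _ _ dwP.
have dm := is_derive_gibbs_mean _ _ _ i0 dwP.
have dl := is_derive1_comp (is_derive1_ln Z0) dZ.
have H := is_deriveB dl dm.
apply: is_derive_eq H _.
rewrite mulr_sumr !mulr_suml -sumrB mulNr mulr_suml -sumrN.
by apply: eq_bigr => k _; field; rewrite gt_eqF.
Qed.

(** Rotations preserve the sum of squares, so they are curves on the sphere along which a minimizer
    can be tested without Lagrange multipliers. *)
Definition plane_rot u (i j : 'I_n) (k : 'I_n) (t : R) : R :=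
  if k == i then u i * cos t - u j * sin t
  else if k == j then u i * sin t + u j * cos t else u k.

Lemma is_derive_plane_rot u i j k (t : R) : i != j ->
  is_derive t 1 (plane_rot u i j k)
    (if k == i then - plane_rot u i j j t else if k == j then plane_rot u i j i t else 0).
Proof.
move=> ij; rewrite /plane_rot eqxx [j == i]eq_sym (negbTE ij) eqxx.
case: (k == i); last case: (k == j).
- have H := is_deriveB (is_deriveM (is_derive_cst (u i) t 1) (is_derive_cos t))
    (is_deriveM (is_derive_cst (u j) t 1) (is_derive_sin t)).
  by apply: is_derive_eq H _; rewrite /= /GRing.scale /=; ring.
- have H := is_deriveD (is_deriveM (is_derive_cst (u i) t 1) (is_derive_sin t))
    (is_deriveM (is_derive_cst (u j) t 1) (is_derive_cos t)).
  by apply: is_derive_eq H _; rewrite /= /GRing.scale /=; ring.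
- exact: is_derive_cst.
Qed.

Lemma plane_rot0 u i j k : plane_rot u i j k 0 = u k.
Proof.
rewrite /plane_rot cos0 sin0 !mulr1 !mulr0 subr0 add0r.
by case: eqP => [->//|_]; case: eqP => [->|].
Qed.

Lemma sum_plane_rot_sqr u i j (t : R) : i != j ->
  \sum_k plane_rot u i j k t ^+ 2 = \sum_k u k ^+ 2.
Proof.
move=> ij; rewrite !(bigD1 (P:=predT) i) //= !(bigD1 (P:=fun k => k != i) j) 1?eq_sym //=.
rewrite !addrA; congr (_ + _).
  rewrite /plane_rot eqxx [j == i]eq_sym (negbTE ij) eqxx.
  have := cos2Dsin2 t; set c := cos t; set s := sin t => cs.
  transitivity ((u i ^+ 2 + u j ^+ 2) * (c ^+ 2 + s ^+ 2)); first ring.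
  by rewrite cs mulr1.
by apply: eq_bigr => k /andP[ki kj]; rewrite /plane_rot (negbTE ki) (negbTE kj).
Qed.

(** Only the coordinates [i] and [j] move, with velocities [-y] and [x]. The numerator is [x y]
    times the difference of the values of [e^x (1 - m / x)], in a form that allows zero
    coordinates. *)
Lemma is_derive_entropy_plane_rot u i j (t : R) : i != j ->
  let x := plane_rot u i j i t in let y := plane_rot u i j j t in
  let m := gibbs_mean ((plane_rot u i j)^~ t) in
  is_derive t 1 (fun s => logit_entropy ((plane_rot u i j)^~ s))
    (((x - m) * expR x * y - (y - m) * expR y * x)
       / partition_fun ((plane_rot u i j)^~ t)).
Proof.
move=> ij x y m.
have H := is_derive_logit_entropy _ _ _ i (fun k => is_derive_plane_rot u i j k t ij).
apply: is_derive_eq H _; congr (_ / _).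
rewrite -/m (bigD1 i) //= (bigD1 j) 1?eq_sym //= big1 ?addr0; last first.
  by move=> k /andP[ki kj]; rewrite (negbTE ki) (negbTE kj) mulr0.
by rewrite eqxx [j == i]eq_sym (negbTE ij) eqxx -/x -/y; ring.
Qed.

End LogitEntropy.

(** * Minimizers of the entropy on a sphere: existence and first-order conditions *)

Section SphereMinimizer.
Context {R : realType} {n : nat}.
Implicit Types (u : 'I_n -> R).

Lemma continuous_sum_fct {T : topologicalType} (f : 'I_n -> T -> R) :
  (forall i, continuous (f i)) -> continuous (fun x => \sum_i f i x).
Proof.
by move=> fc; apply: continuous_big => [|i _]; [exact: add_continuous|exact: fc].
Qed.

Lemma continuous_logit_entropy {T : topologicalType} (f : 'I_n -> T -> R)
    (i0 : 'I_n) :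
  (forall i, continuous (f i)) -> continuous (fun x => logit_entropy (f^~ x)).
Proof.
move=> fc.
have ec i : continuous (fun x => expR (f i x)).
  by move=> x; apply: continuous_comp; [exact: fc|exact: continuous_expR].
have Zc : continuous (fun x => partition_fun (f^~ x)).
  exact: continuous_sum_fct.
move=> x; have Z0 := partition_fun_gt0 (f^~ x) i0.
apply: cvgB.
  apply: (@continuous_comp _ _ _ (fun x => partition_fun (f^~ x)) (@ln R)).
    exact: Zc.
  exact: continuous_ln.
apply: cvgM; last by apply: cvgV; [rewrite gt_eqF|exact: Zc].
apply: continuous_sum_fct => i y; apply: cvgM; last exact: ec.
exact: fc.
Qed.

Definition sphere_minimizer u := forall w : 'I_n -> R,
  \sum_i w i ^+ 2 = \sum_i u i ^+ 2 -> logit_entropy u <= logit_entropy w.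

(** Extreme value theorem on the sphere through [u0], viewed among row vectors. It is closed, and
    bounded in the sup norm because each coordinate is at most the Euclidean radius. *)
Lemma sphere_minimizer_exists u0 (i0 : 'I_n) :
  exists u, \sum_i u i ^+ 2 = \sum_i u0 i ^+ 2 /\ sphere_minimizer u.
Proof.
pose sq (x : 'rV[R]_n) : R := \sum_i x ord0 i ^+ 2.
pose A : set 'rV[R]_n := (sq @^-1` [set \sum_i u0 i ^+ 2])%classic.
have sqc : continuous sq.
  apply: continuous_sum_fct => i x.
  apply: (@continuous_comp _ _ _ (fun x : 'rV[R]_n => x ord0 i) (fun y => y ^+ 2)).
    exact: coord_continuous.
  exact: exprn_continuous.
have rowE (w : 'I_n -> R) : (\row_i w i) ord0 = w.
  by apply/funext => i; rewrite mxE.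
have A0 : (A !=set0)%classic.
  exists (\row_i u0 i); rewrite /A /= /sq.
  by apply: eq_bigr => i _; rewrite mxE.
have Acl : closed A.
  apply: preimage_closed; [by move=> x _; exact: sqc|exact: closed_eq].
have Abd : bounded_set A.
  exists (Num.sqrt (\sum_i u0 i ^+ 2)); split; first exact: num_real.
  move=> M hM x Ax; apply: ltW; apply: le_lt_trans hM.
  rewrite /Num.norm /= mx_normrE; apply: bigmax_le; first exact: sqrtr_ge0.
  move=> [a i] _ /=; rewrite (ord1 a) -sqrtr_sqr ler_wsqrtr // -[leRHS]Ax /sq.
  by rewrite (bigD1 i) //= lerDl; apply: sumr_ge0 => j _; exact: sqr_ge0.
have Hc : continuous (fun x : 'rV[R]_n => logit_entropy (x ord0)).
  apply: (continuous_logit_entropy (fun i (x : 'rV[R]_n) => x ord0 i) i0) => i.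
  exact: coord_continuous.
have [c cA cmin] := EVT_min_rV A0 (bounded_closed_compact Abd Acl)
  (continuous_subspaceT Hc).
have cs : \sum_i c ord0 i ^+ 2 = \sum_i u0 i ^+ 2 by move: cA; rewrite inE.
exists (c ord0); split=> // w; rewrite cs => ws.
rewrite -(rowE w); apply: cmin; rewrite inE /A /= /sq -ws.
by apply: eq_bigr => i _; rewrite mxE.
Qed.

(* [e^x (1 - m / x) < e^y (1 - m / y)] multiplied by [x y]; the last hypothesis
   covers both [x < y < 0] and [m < x < y]. *)
Lemma tilted_logit_lt (m x y : R) : 0 < m -> x < y -> 0 <= (x - m) * y ->
  (x - m) * expR x * y < (y - m) * expR y * x.
Proof.
move=> m0 xy hx.
have h : (x - m) * y < (y - m) * x by nra.
rewrite -!mulrA ![expR _ * _]mulrC !mulrA.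
apply: le_lt_trans (_ : (x - m) * y * expR y < _).
  by apply: ler_wpM2l => //; rewrite ler_expR ltW.
by rewrite ltr_pM2r ?expR_gt0.
Qed.

Lemma sum_tilted0 u (i0 : 'I_n) : \sum_i (u i - gibbs_mean u) * expR (u i) = 0.
Proof.
have Z0 := partition_fun_gt0 u i0.
rewrite (eq_bigr _ (fun _ _ => mulrBl _ _ _)) sumrB -mulr_sumr.
by rewrite -/(partition_fun u) /gibbs_mean divfK ?subrr // gt_eqF.
Qed.

Lemma plane_rot0E u i j : (plane_rot u i j)^~ 0 = u.
Proof. by apply/funext => k; rewrite plane_rot0. Qed.

(** Along the rotation in the plane [(i, j)] the entropy has an interior minimum at angle 0, so its
    derivative there vanishes. *)
Lemma sphere_minimizer_stationary u i j : sphere_minimizer u ->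
  let m := gibbs_mean u in
  (u i - m) * expR (u i) * u j = (u j - m) * expR (u j) * u i.
Proof.
move=> umin m; have [->//|ij] := eqVneq i j.
have D0 := is_derive_entropy_plane_rot u i j 0 ij.
have := @derive1_at_min R (fun s => logit_entropy ((plane_rot u i j)^~ s)) (-1) 1 0.
move=> /(_ ltac:(lra)) /(_ _)/(_ _)/(_ _) [].
- by move=> t _; have [] := is_derive_entropy_plane_rot u i j t ij.
- by rewrite in_itv /=; apply/andP; split; lra.
- by move=> t _; rewrite plane_rot0E; apply: umin; exact: sum_plane_rot_sqr.
move=> _; rewrite (@derive_val _ _ _ _ _ _ _ D0) plane_rot0E !plane_rot0 -/m.
have Z0 := partition_fun_gt0 u i.
move/eqP; rewrite mulf_eq0 invr_eq0 (gt_eqF Z0) orbF subr_eq0.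
by move/eqP.
Qed.

(** Stationarity kills the derivative at angle 0, so small positive angles are examined instead:
    they push the larger coordinate further above the smaller one, [tilted_logit_lt] makes the
    derivative negative there, and the mean value theorem yields a smaller entropy on the same
    sphere. *)
Lemma sphere_minimizer_above_mean_uniq u i j : sphere_minimizer u ->
  let m := gibbs_mean u in 0 < m -> m < u i -> m < u j -> i = j.
Proof.
move=> umin m; wlog xy : i j / u i <= u j.
  move=> H m0 hi hj; case: (lerP (u i) (u j)) => [|/ltW] h; first exact: H.
  by apply/esym; exact: H.
move=> m0 hi hj; apply/eqP/negPn/negP => ij.
pose H s := logit_entropy ((plane_rot u i j)^~ s).
pose M s := gibbs_mean ((plane_rot u i j)^~ s).
have dM (t : R) := is_derive_gibbs_mean _ _ t i
  (fun k => is_derive_plane_rot u i j k t ij).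
have Mc : {for 0, continuous M}.
  by apply: differentiable_continuous; apply/derivable1_diffP; have [] := dM 0.
have xc : {for 0, continuous (plane_rot u i j i)}.
  apply: differentiable_continuous; apply/derivable1_diffP.
  by have [] := is_derive_plane_rot u i j i 0 ij.
have n1 : \forall t \near (0:R), 0 < M t.
  by apply: (cvgr_gt (M 0) Mc); rewrite /M plane_rot0E.
have n2 : \forall t \near (0:R), 0 < (plane_rot u i j i - M) t.
  apply: (cvgr_gt ((plane_rot u i j i - M) 0) (continuousB xc Mc)).
  by rewrite /M /= !fctE plane_rot0 plane_rot0E subr_gt0.
have [e /= e0 he] := (nbhs_ballP _ _).1 (filterI n1 n2).
(* Below [e], the mean stays positive and below the rotated coordinate [i]; the cap 1, which is at
   most [pi / 2], keeps [sin c] and [cos c] positive. *)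
pose d := Num.min (e / 2) 1.
have d0 : 0 < d by rewrite lt_min ltr01 divr_gt0.
have de : d < e by rewrite gt_min; apply/orP; left; lra.
have d1 : d <= 1 by rewrite ge_min lexx orbT.
have [|||c] := @MVT R H (fun t => let x := plane_rot u i j i t in
    let y := plane_rot u i j j t in
    let m := gibbs_mean ((plane_rot u i j)^~ t) in
    ((x - m) * expR x * y - (y - m) * expR y * x)
       / partition_fun ((plane_rot u i j)^~ t)) 0 d.
- exact: d0.
- by move=> t _; exact: is_derive_entropy_plane_rot.
- apply: continuous_subspaceT => t.
  apply: differentiable_continuous; apply/derivable1_diffP.
  by have [] := is_derive_entropy_plane_rot u i j t ij.
rewrite in_itv /= => /andP[c0 cd] Hd.
have : H 0 <= H d by rewrite /H plane_rot0E; apply: umin; exact: sum_plane_rot_sqr.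
rewrite -subr_ge0 Hd subr0 pmulr_lge0 // leNgt => /negP; apply.
have [Mc0 xMc] : 0 < M c /\ 0 < (plane_rot u i j i - M) c.
  by apply: he; rewrite /ball /= sub0r normrN gtr0_norm //; apply: lt_trans de.
rewrite pmulr_llt0 ?invr_gt0 ?(partition_fun_gt0 _ i) // subr_lt0.
have pi1 := pihalf_ge1 R.
have s0 : 0 < sin c by apply: sin_gt0_pihalf; apply/andP; split => //; lra.
have co0 : 0 < cos c by apply: cos_gt0_pihalf; apply/andP; split => //; lra.
(* The difference is [(u j - u i) cos c + (u i + u j) sin c], positive even when [u i = u j]. *)
have xy' : plane_rot u i j i c < plane_rot u i j j c.
  rewrite /plane_rot eqxx [j == i]eq_sym (negbTE ij) eqxx.
  have : 0 < u i by apply: lt_trans hi.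
  have := mulr_gt0 s0 (lt_trans m0 hi); have := mulr_gt0 s0 (lt_trans m0 hj).
  by nra.
move: xMc; rewrite !fctE subr_gt0 => xMc.
apply: tilted_logit_lt => //; rewrite mulr_ge0 ?subr_ge0 ?ltW //.
by apply: lt_trans xy'; apply: lt_trans xMc.
Qed.

End SphereMinimizer.

(** * Vectors with one exceptional coordinate, and the sharp bound on spheres *)

Section TwoLevel.
Context {R : realType} {n : nat}.
Implicit Types (u : 'I_n -> R).

(* The entropy of the softmax of [(d, 0, ..., 0)]. *)
Definition two_level_entropy (d : R) : R :=
  ln (1 + (n%:R - 1) * expR (- d))
  + (n%:R - 1) * d * expR (- d) / (1 + (n%:R - 1) * expR (- d)).

Lemma sum_neq_const (i0 : 'I_n) (c : R) : \sum_(k | k != i0) c = (n%:R - 1) * c.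
Proof.
have : \sum_(k < n) c = n%:R * c by rewrite sumr_const card_ord mulr_natl.
by rewrite (bigD1 i0) //=; lra.
Qed.

(** Entropy is invariant under shifting all logits, so only the gap [u i0 - b] matters; the
    computation factors [e^(u i0)] out of [Z]. *)
Lemma logit_entropy_two_level u (i0 : 'I_n) (b : R) :
  (forall k, k != i0 -> u k = b) ->
  logit_entropy u = two_level_entropy (u i0 - b).
Proof.
move=> ub; have Z0 := partition_fun_gt0 u i0.
pose N : R := n%:R - 1; pose q := 1 + N * expR (- (u i0 - b)).
have eb : expR b = expR (u i0) * expR (- (u i0 - b)).
  by rewrite -expRD; congr expR; ring.
have ZE : partition_fun u = expR (u i0) * q.
  rewrite /partition_fun (bigD1 i0) //= (eq_bigr (fun=> expR b)).
    by rewrite sum_neq_const eb /q /N; ring.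
  by move=> k /ub ->.
have q0 : 0 < q by move: Z0; rewrite ZE pmulr_rgt0 ?expR_gt0.
have e0 := expR_gt0 (u i0).
have mE : gibbs_mean u = u i0 - N * (u i0 - b) * expR (- (u i0 - b)) / q.
  rewrite /gibbs_mean ZE (bigD1 i0) //= (eq_bigr (fun=> b * expR b)).
    rewrite sum_neq_const -/N eb.
    move: q0 e0; rewrite /q; move: (expR _) (expR _) => x e q0 e0.
    by field; rewrite !gt_eqF.
  by move=> k /ub ->.
rewrite /logit_entropy ZE mE lnM ?posrE // expRK /two_level_entropy -/N -/q.
by ring.
Qed.

(** Along [(t, 0, ..., 0)] the derivative is [-(t - m) e^t / Z], and [m <= t] for [t >= 0] since [m]
    is a weighted average of [t] and zeros. *)
Lemma two_level_entropy_nincr (i0 : 'I_n) (x y : R) :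
  0 <= x -> x <= y -> two_level_entropy y <= two_level_entropy x.
Proof.
pose w (k : 'I_n) : R -> R := if k == i0 then id else cst 0.
have gE t : two_level_entropy t = logit_entropy (w^~ t).
  rewrite (@logit_entropy_two_level _ i0 0) /w ?eqxx /= ?subr0 //.
  by move=> k /negbTE ->.
have dwP (t : R) k : is_derive t 1 (w k) (k == i0)%:R.
  by rewrite /w; case: eqP => _; [exact: is_derive_id|exact: is_derive_cst].
have dg (t : R) : is_derive t 1 two_level_entropy
    (- ((t - gibbs_mean (w^~ t)) * expR t) / partition_fun (w^~ t)).
  rewrite (funext gE); have H := is_derive_logit_entropy _ _ t i0 (dwP t).
  apply: is_derive_eq H _; congr (- _ / _).
  rewrite (bigD1 i0) //= big1 ?addr0.
    by rewrite /w eqxx /= mulr1.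
  by move=> k /negbTE ->; rewrite mulr0.
apply: ler0_derive1_nincry.
- by move=> t _; have [] := dg t.
- move=> t; rewrite in_itv /= andbT => t0.
  rewrite derive1E (@derive_val _ _ _ _ _ _ _ (dg t)) mulNr oppr_le0.
  have Z0 := partition_fun_gt0 (w^~ t) i0.
  rewrite divr_ge0 ?(ltW Z0) // mulr_ge0 ?expR_ge0 // subr_ge0.
  rewrite /gibbs_mean ler_pdivrMr // /partition_fun mulr_sumr.
  apply: ler_sum => k _; rewrite ler_wpM2r ?expR_ge0 // /w.
  by case: eqP => _ //=; exact: ltW.
- apply: continuous_subspaceT => t.
  by apply: differentiable_continuous; apply/derivable1_diffP; have [] := dg t.
Qed.

Lemma logit_entropy_ge u : (2 <= n)%N ->
  two_level_entropy (Num.sqrt ((\sum_i u i ^+ 2) * (n%:R / (n%:R - 1))))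
    <= logit_entropy u.
Proof.
move=> n2; have i0 : 'I_n by exists 0; exact: leq_trans n2.
have N0 : 0 < n%:R - 1 :> R by rewrite subr_gt0 ltr1n.
have [v [vs vmin]] := sphere_minimizer_exists u i0.
apply: le_trans (vmin _ (esym vs)); rewrite -vs.
have /= st i j := sphere_minimizer_stationary v i j vmin.
have /= le1 i j := sphere_minimizer_above_mean_uniq v i j vmin.
set m := gibbs_mean v in st le1.
(* A constant minimizer has gap 0, where [two_level_entropy] is largest on nonnegative gaps. *)
case: (pselect (forall k, k != i0 -> v k = v i0)) => [vc|vnc].
  rewrite (logit_entropy_two_level _ _ _ vc) subrr.
  exact: (two_level_entropy_nincr i0).
(* Summing stationarity over the second index gives [(v j - m) e^(v j) S = 0], with [S] the sum of
   [v]; a nonzero [S] would force every [v j = m]. *)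
have S0 : \sum_i v i = 0.
  apply/eqP/negPn/negP => S0; apply: vnc => k _.
  have vm j : v j = m.
    have : \sum_i (v j - m) * expR (v j) * v i = 0.
      under eq_bigr do rewrite st.
      by rewrite -mulr_suml sum_tilted0 // mul0r.
    rewrite -mulr_sumr => /eqP; rewrite !mulf_eq0 (negbTE S0) orbF.
    by rewrite (gt_eqF (expR_gt0 _)) orbF subr_eq0 => /eqP.
  by rewrite !vm.
have Z0 := partition_fun_gt0 v i0.
have vnz : exists j, v j != 0.
  apply/existsP; apply: contraT => /existsPn H; case: vnc => k _.
  by rewrite (eqP (negPn (H k))) (eqP (negPn (H i0))).
(* Termwise [x <= x e^x], strictly for [x != 0], so [m Z] exceeds the sum of [v], which is 0. *)
have m0 : 0 < m.
  rewrite /m /gibbs_mean divr_gt0 // -[X in X < _]S0.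
  have pos (x : R) : x != 0 -> x < x * expR x.
    rewrite neq_lt => /orP[] x0.
      by rewrite ltr_nMr // expR_lt1.
    by rewrite ltr_pMr // expR_gt1.
  have [j vj] := vnz; rewrite !(bigD1 (P:=predT) j) //=.
  apply: ltr_leD; first exact: pos.
  apply: ler_sum => k _; have [->|/pos/ltW//] := eqVneq (v k) 0.
  by rewrite mul0r.
(* Otherwise the terms [(m - v i) e^(v i)] are nonnegative with sum 0, so all vanish and [v] is
   constant. *)
have [i im] : exists i, m < v i.
  apply/existsP; apply: contraT => /existsPn H.
  have : \sum_i (m - v i) * expR (v i) = 0.
    apply: oppr_inj; rewrite oppr0 -[RHS](sum_tilted0 v i0) -sumrN.
    by apply: eq_bigr => k _; rewrite -mulNr opprB.
  move/eqP; rewrite psumr_eq0; last first.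
    by move=> k _; rewrite mulr_ge0 ?expR_ge0 // subr_ge0 leNgt H.
  move/allP => H'; case: vnc => k _.
  have vm j : v j = m.
    have := H' j (mem_index_enum _); rewrite /= mulf_eq0 (gt_eqF (expR_gt0 _)) orbF.
    by rewrite subr_eq0 => /eqP.
  by rewrite !vm.
have vi0 := lt_trans m0 im.
(* Stationarity against [i] rules out [v k = 0], and turns [v k > 0] into [v k > m], which
   uniqueness above the mean forbids. *)
have neg k : k != i -> v k < 0.
  move=> ki; have [] // := ltrgt0P (v k); last first.
    move=> vk0; have := st k i; rewrite vk0 expR0 !mulr0 => /eqP.
    by rewrite sub0r mulr1 mulf_eq0 oppr_eq0 !gt_eqF.
  move=> vk0; exfalso; move/eqP: ki; apply; apply: le1 => //.
  have : 0 < (v k - m) * expR (v k) * v i.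
    by rewrite st !mulr_gt0 ?expR_gt0 // subr_gt0.
  by rewrite pmulr_lgt0 // pmulr_lgt0 ?expR_gt0 // subr_gt0.
have negeq k l : k != i -> l != i -> v k = v l.
  move=> ki li; apply/eqP; rewrite eq_le; apply/andP.
  have aux a b : a != i -> b != i -> v a <= v b.
    move=> ai bi; rewrite leNgt; apply/negP => ba.
    have := tilted_logit_lt m _ _ m0 ba; rewrite st ltxx => H.
    have va := neg _ ai; have vb := neg _ bi.
    by suff : false by []; apply: H; nra.
  by split; exact: aux.
have [j ji] : exists j, j != i.
  apply/existsP; apply: contraT => /existsPn H; case: vnc => k _.
  by rewrite (eqP (negPn (H k))) (eqP (negPn (H i0))).
rewrite (logit_entropy_two_level v i (v j)); last by move=> k ki; exact: negeq.
suff -> : Num.sqrt ((\sum_k v k ^+ 2) * (n%:R / (n%:R - 1))) = v i - v j by [].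
(* With [a = v i] and [b = v j], this gives [a - b = -n b] and a sum of squares [n (n - 1) b^2],
   whence the factor [n / (n - 1)] under the root. *)
have SE : v i + (n%:R - 1) * v j = 0.
  rewrite -S0 (bigD1 i) //= (eq_bigr (fun=> v j)) ?sum_neq_const //.
  by move=> k ki; exact: negeq.
have QE : \sum_k v k ^+ 2 = v i ^+ 2 + (n%:R - 1) * v j ^+ 2.
  rewrite (bigD1 i) //= [in LHS](eq_bigr (fun=> v j ^+ 2)) ?sum_neq_const //.
  by move=> k ki; rewrite (negeq k j).
have vj := neg _ ji.
rewrite QE -[RHS]ger0_norm ?subr_ge0; last by rewrite ltW // (lt_trans vj).
rewrite -sqrtr_sqr; congr Num.sqrt.
have -> : v i = - ((n%:R - 1) * v j) by lra.
by field; rewrite gt_eqF.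
Qed.

End TwoLevel.
Arguments two_level_entropy {R} n d.

(** * Euclidean norm, spectral norm and the transpose *)

Section SpectralNorm.
Context {R : realType}.

Lemma vnorm2_ge0 k (x : 'cV[R]_k) : 0 <= vnorm2 x.
Proof. exact: sqrtr_ge0. Qed.

Lemma sqr_vnorm2 k (x : 'cV[R]_k) : vnorm2 x ^+ 2 = \sum_i x i ord0 ^+ 2.
Proof. by rewrite sqr_sqrtr // sumr_ge0 // => i _; exact: sqr_ge0. Qed.

Lemma vnorm2Z k (a : R) (x : 'cV[R]_k) : vnorm2 (a *: x) = `|a| * vnorm2 x.
Proof.
rewrite -sqrtr_sqr /vnorm2 -sqrtrM ?sqr_ge0 // mulr_sumr.
by congr Num.sqrt; apply: eq_bigr => i _; rewrite mxE exprMn.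
Qed.

Lemma vnorm2_eq0 k (x : 'cV[R]_k) : vnorm2 x = 0 -> x = 0.
Proof.
move=> x0; apply/matrixP => i j; rewrite (ord1 j) mxE.
have := sqr_vnorm2 _ x; rewrite x0 expr0n /= => /esym/eqP.
rewrite psumr_eq0 => [/allP/(_ i (mem_index_enum _))|l _]; last exact: sqr_ge0.
by rewrite /= sqrf_eq0 => /eqP.
Qed.

(** Expanding the sum of [(b x_i - a y_i)^2], with [a] and [b] the two norms, gives
    [2 a b (a b - <x, y>) >= 0]; the cases [a = 0] and [b = 0] are treated apart to cancel [a b]. *)
Lemma cauchy_schwarz_vnorm2 k (x y : 'cV[R]_k) :
  \sum_i x i ord0 * y i ord0 <= vnorm2 x * vnorm2 y.
Proof.
set a := vnorm2 x; set b := vnorm2 y.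
have a0 : 0 <= a := vnorm2_ge0 _ x; have b0 : 0 <= b := vnorm2_ge0 _ y.
have [ha|ha] := eqVneq a 0.
  by rewrite ha mul0r big1 // => i _; rewrite (vnorm2_eq0 _ _ ha) mxE mul0r.
have [hb|hb] := eqVneq b 0.
  by rewrite hb mulr0 big1 // => i _; rewrite (vnorm2_eq0 _ _ hb) mxE mulr0.
have a1 : 0 < a by rewrite lt_neqAle eq_sym ha.
have b1 : 0 < b by rewrite lt_neqAle eq_sym hb.
have : 0 <= \sum_i (b * x i ord0 - a * y i ord0) ^+ 2.
  by apply: sumr_ge0 => i _; exact: sqr_ge0.
have -> : \sum_i (b * x i ord0 - a * y i ord0) ^+ 2 =
    b ^+ 2 * a ^+ 2 + a ^+ 2 * b ^+ 2 - 2 * a * b * \sum_i x i ord0 * y i ord0.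
  transitivity (b ^+ 2 * (\sum_i x i ord0 ^+ 2) + a ^+ 2 * (\sum_i y i ord0 ^+ 2)
      - 2 * a * b * \sum_i x i ord0 * y i ord0); last by rewrite -!sqr_vnorm2.
  rewrite !mulr_sumr -big_split -sumrB /=.
  by apply: eq_bigr => i _; ring.
have ab := mulr_gt0 a1 b1.
move=> H; have : 0 <= 2 * (a * b) * (a * b - \sum_i x i ord0 * y i ord0) by lra.
by rewrite pmulr_rge0 ?subr_ge0 // mulr_gt0.
Qed.

(** Normalizing [x] reduces to the unit sphere, but [sup] bounds its set only once that set is known
    to be bounded above. *)
Lemma spec_norm_ub m n (A : 'M[R]_(m, n)) (x : 'cV[R]_n) :
  vnorm2 (A *m x) <= spec_norm A * vnorm2 x.
Proof.
have ub : has_ubound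
    [set vnorm2 (A *m x) | x in [set x : 'cV[R]_n | vnorm2 x = 1]]%classic.
  (* The bound is the Frobenius norm, by Cauchy-Schwarz on each row. *)
  exists (Num.sqrt (\sum_i vnorm2 (\col_j A i j) ^+ 2)) => _ [y /= y1 <-].
  rewrite ler_wsqrtr //; apply: ler_sum => i _.
  rewrite mxE -real_normK ?num_real // ler_sqr ?nnegrE ?vnorm2_ge0 // ler_norml.
  have H z : vnorm2 z = 1 -> \sum_j A i j * z j ord0 <= vnorm2 (\col_j A i j).
    move=> z1; rewrite -[leRHS]mulr1 -z1.
    apply: le_trans (cauchy_schwarz_vnorm2 _ _ _).
    by apply: ler_sum => j _; rewrite mxE.
  apply/andP; split; last exact: H.
  rewrite lerNl; apply: le_trans (H (- y) _).
    by rewrite -sumrN; apply: ler_sum => j _; rewrite mxE mulrN.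
  by rewrite -scaleN1r vnorm2Z normrN1 mul1r.
have [x0|x0] := eqVneq (vnorm2 x) 0.
  rewrite x0 mulr0 (vnorm2_eq0 _ _ x0) le_eqVlt; apply/orP; left; apply/eqP.
  by rewrite mulmx0 /vnorm2 big1 ?sqrtr0 // => i _; rewrite mxE expr0n.
have x1 : 0 < vnorm2 x by rewrite lt_neqAle eq_sym x0 vnorm2_ge0.
rewrite -ler_pdivrMr // mulrC -[X in X * _]gtr0_norm ?invr_gt0 // -vnorm2Z scalemxAr.
apply: ub_le_sup => //=; exists ((vnorm2 x)^-1 *: x) => //=.
by rewrite vnorm2Z gtr0_norm ?invr_gt0 // mulVf.
Qed.

Lemma spec_norm_ge0 m n (A : 'M[R]_(m, n)) : (0 < n)%N -> 0 <= spec_norm A.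
Proof.
move=> n0; have := spec_norm_ub _ _ A (const_mx 1).
suff x1 : 0 < vnorm2 (const_mx 1 : 'cV[R]_n).
  by move/(le_trans (vnorm2_ge0 _ _)); rewrite pmulr_lge0.
rewrite sqrtr_gt0 (eq_bigr (fun=> 1)) => [|i _]; last by rewrite mxE expr1n.
by rewrite sumr_const card_ord ltr0n.
Qed.

(* [|A^T y|^2 = <y, A A^T y>]. *)
Lemma spec_norm_tr_ub m n (A : 'M[R]_(m, n)) (y : 'cV[R]_m) : (0 < n)%N ->
  vnorm2 (A^T *m y) <= spec_norm A * vnorm2 y.
Proof.
move=> n0; set z := A^T *m y.
have zz : vnorm2 z ^+ 2 = \sum_i (A *m z) i ord0 * y i ord0.
  rewrite sqr_vnorm2.
  have -> : \sum_i z i ord0 ^+ 2 = (z^T *m z) ord0 ord0.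
    by rewrite mxE; apply: eq_bigr => i _; rewrite [z^T _ _]mxE.
  have -> : \sum_i (A *m z) i ord0 * y i ord0 = ((A *m z)^T *m y) ord0 ord0.
    by rewrite mxE; apply: eq_bigr => i _; rewrite [_^T _ _]mxE.
  by rewrite [(A *m z)^T]trmx_mul -mulmxA.
have := le_trans (cauchy_schwarz_vnorm2 _ (A *m z) y)
  (ler_wpM2r (vnorm2_ge0 _ y) (spec_norm_ub _ _ A z)).
rewrite -zz; have := vnorm2_ge0 _ z; rewrite le_eqVlt => /predU1P[<- H|z0].
  by rewrite mulr_ge0 ?spec_norm_ge0 ?vnorm2_ge0.
by rewrite expr2 mulrAC ler_pM2r.
Qed.

End SpectralNorm.

Theorem theorem4p2 (R : realType) (D V : nat) (hD : (1 <= D)%N) (hV : (2 <= V)%N)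
  (C : 'M[R]_(D, V)) (h : 'cV[R]_D) (sigmaC sigmah : R)
  (hC : spec_norm C = sigmaC)
  (hh : forall i : 'I_D, `|h i ord0| <= sigmah) :
  let rho := sigmaC * sigmah in
  let u := C^T *m h in
  let gamma := expR (- (rho * Num.sqrt ((D * V)%:R / (V%:R - 1)))) in
  softmax_entropy u >=
    ln (1 + (V%:R - 1) * gamma)
    + rho * gamma * Num.sqrt ((D * V)%:R * (V%:R - 1)) / (1 + (V%:R - 1) * gamma).
Proof.
lazy zeta; set rho := sigmaC * sigmah; set u := C^T *m h.
set gamma := expR (- (rho * Num.sqrt _)).
have [V1 D1] : (0 < V)%N /\ (0 < D)%N by split=> //; exact: leq_trans hV.
have i0 : 'I_V by exists 0.
have N0 : 0 < V%:R - 1 :> R by rewrite subr_gt0 ltr1n.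
have sh0 : 0 <= sigmah by apply: le_trans (hh (Ordinal D1)).
have sC0 : 0 <= sigmaC by rewrite -hC spec_norm_ge0.
have rho0 : 0 <= rho by exact: mulr_ge0.
pose d := rho * Num.sqrt ((D * V)%:R / (V%:R - 1)).
have h2 : vnorm2 h ^+ 2 <= sigmah ^+ 2 * D%:R.
  rewrite sqr_vnorm2 mulr_natr -[D in leRHS]card_ord -sumr_const.
  by apply: ler_sum => i _; rewrite -real_normK ?num_real // ler_sqr ?nnegrE.
have u2 : \sum_i u i ord0 ^+ 2 <= rho ^+ 2 * D%:R.
  rewrite -sqr_vnorm2; apply: le_trans (_ : (sigmaC * vnorm2 h) ^+ 2 <= _).
    rewrite ler_sqr ?nnegrE ?mulr_ge0 ?vnorm2_ge0 // -hC.
    exact: spec_norm_tr_ub.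
  have -> : (sigmaC * vnorm2 h) ^+ 2 = sigmaC ^+ 2 * vnorm2 h ^+ 2 by ring.
  have -> : rho ^+ 2 * D%:R = sigmaC ^+ 2 * (sigmah ^+ 2 * D%:R) by rewrite /rho; ring.
  by apply: ler_wpM2l h2; exact: sqr_ge0.
(* The claimed bound is the two-level entropy at gap [d], because [sqrt (D V (V - 1)) = (V - 1) sqrt
   (D V / (V - 1))]. *)
have -> : ln (1 + (V%:R - 1) * gamma)
    + rho * gamma * Num.sqrt ((D * V)%:R * (V%:R - 1)) / (1 + (V%:R - 1) * gamma)
    = two_level_entropy V d.
  rewrite /two_level_entropy -/gamma; congr (_ + _ / _).
  have -> : Num.sqrt ((D * V)%:R * (V%:R - 1)) =
      (V%:R - 1) * Num.sqrt ((D * V)%:R / (V%:R - 1)) :> R.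
    rewrite -[X in X * Num.sqrt _](gtr0_norm N0) -sqrtr_sqr -sqrtrM ?sqr_ge0 //.
    by congr Num.sqrt; field; rewrite gt_eqF.
  by rewrite /d; ring.
rewrite (softmax_entropyE _ i0).
apply: le_trans (logit_entropy_ge (fun i => u i ord0) hV).
(* What remains is that the gap [|u| sqrt (V / (V - 1))] is at most [d], which follows from [u2]. *)
apply: (two_level_entropy_nincr i0); first exact: sqrtr_ge0.
rewrite /d -[X in X * Num.sqrt _](ger0_norm rho0) -sqrtr_sqr -sqrtrM ?sqr_ge0 //.
apply: ler_wsqrtr; rewrite natrM -[D%:R * _ / _]mulrA [leRHS]mulrA.
by apply: ler_wpM2r => //; rewrite divr_ge0 // ltW.
Qed.
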